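(* Let $\lambda$ and $\delta$ be two proper partitions. For every proper partition $\rho$ let ${c'}_{\lambda\delta}^{\rho}(n)$ be defined, for $n$ sufficiently large, by $$\mathbf{K}_{\underline{\lambda}_n}\mathbf{K}_{\underline{\delta}_n}=\sum_{\rho \text{ proper partition},\ |\rho|\le n} {c'}_{\lambda\delta}^{\rho}(n)\, \mathbf{K}_{\underline{\rho}_n}$$ in the double-class algebra $\mathbb{C}[\mathcal{B}_n\setminus\mathcal{S}_{2n}/\mathcal{B}_n]$. Then for each proper partition $\rho$ the quotient $\dfrac{{c'}_{\lambda\delta}^{\rho}(n)}{2^nn!}$ is, for $n$ sufficiently large, a polynomial in $n$ with rational coefficients.
   Context: A proper partition is a partition with no part equal to $1$ (the empty partition is allowed). For a proper partition $\lambda$ and $n\ge|\lambda|$, $\underline{\lambda}_n=\lambda\cup(1^{n-|\lambda|})$ is the partition of $n$ obtained by adding $n-|\lambda|$ parts equal to $1$. $\mathcal{B}_n$ is the hyperoctahedral subgroup of $\mathcal{S}_{2n}$: the permutations mapping each pair $\{2i-1,2i\}$, $1\le i\le n$, onto a pair $\{2j-1,2j\}$. The coset-type $\mathrm{ct}(\omega)$ of $\omega\in\mathcal{S}_{2n}$ is the partition of $n$ obtained as follows: form the multigraph on vertices $1,\dots,2n$ with vertices labelled additionally by their images $\omega(1),\dots,\omega(2n)$, joining $i$ and $j$ by an edge when $\{i,j\}=\{2r-1,2r\}$ for some $r$, and by another edge when $\{\omega(i),\omega(j)\}=\{2r-1,2r\}$ for some $r$; its connected components are cycles of even lengths $2\rho_1\ge2\rho_2\ge\cdots$,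 and $\mathrm{ct}(\omega)=(\rho_1,\rho_2,\dots)$. Two permutations of $\mathcal{S}_{2n}$ lie in the same double-class $\mathcal{B}_nx\mathcal{B}_n$ iff they have the same coset-type. $K_{\underline{\lambda}_n}=\{\omega\in\mathcal{S}_{2n}:\mathrm{ct}(\omega)=\underline{\lambda}_n\}$ and $\mathbf{K}_{\underline{\lambda}_n}$ is the sum of its elements in $\mathbb{C}[\mathcal{S}_{2n}]$; these sums form a basis of $\mathbb{C}[\mathcal{B}_n\setminus\mathcal{S}_{2n}/\mathcal{B}_n]$. *)

(* Defs.v *)
From mathcomp Require Import all_boot all_order all_fingroup all_algebra.
From mathcomp Require Import all_character.
From mathcomp Require Import reals complex.

Set Implicit Arguments.
Unset Strict Implicit.
Unset Printing Implicit Defensive.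

(* A partition is the nonincreasing sequence of its parts. *)
Definition proper_partition (l : seq nat) : bool :=
  sorted geq l && all (fun k => 1 < k) l.

(* The size |l| is [sumn l].  Only meant for |l| <= n, as the subtraction is
   truncated. *)
Definition pad (n : nat) (l : seq nat) : seq nat :=
  l ++ nseq (n - sumn l) 1.

Definition proper_partitions_upto (n : nat) : seq (seq nat) :=
  [seq l <- [seq map val (s : seq 'I_n.+1) | s : n.-bseq 'I_n.+1]
  | proper_partition l && (sumn l <= n)].

Lemma mem_proper_partitions_upto (n : nat) (l : seq nat) :
  (l \in proper_partitions_upto n) = proper_partition l && (sumn l <= n).
Proof.
rewrite mem_filter; apply: andb_idr => /andP[/andP[_ l_gt1] le_l_n].
have part_le k : k \in l -> k <= n.
  by move=> lk; apply: leq_trans le_l_n; rewrite sumnE (big_rem k lk) leq_addr.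
have size_le : size (pmap insub l : seq 'I_n.+1) <= n.
  apply: leq_trans le_l_n; rewrite size_pmap.
  apply: leq_trans (count_size _ _) _.
  elim: l l_gt1 {part_le} => //= k l IHl /andP[k_gt1 /IHl]; rewrite -add1n.
  by apply: leq_add; apply: ltnW.
apply/imageP; exists (Bseq size_le) => //=.
rewrite pmap_filter; last exact: insubK.
apply/esym/all_filterP/allP => k /part_le le_k_n.
by rewrite insubT.
Qed.

Lemma uniq_proper_partitions_upto (n : nat) : uniq (proper_partitions_upto n).
Proof.
apply/filter_uniq; rewrite map_inj_uniq ?enum_uniq // => s t eq_st.
exact/val_inj/(inj_map val_inj).
Qed.

(* Vertices are numbered from 0, so that the pairs {2r-1, 2r} become
   {2r, 2r+1}: two vertices are in the same pair iff their halves agree. *)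
Definition paired (n : nat) (i j : 'I_n.*2) : bool :=
  (i != j) && (i./2 == j./2).

Definition coset_graph (n : nat) (w : 'S_n.*2) : rel 'I_n.*2 :=
  fun i j => paired i j || paired (w i) (w j).

Definition coset_type (n : nat) (w : 'S_n.*2) : seq nat :=
  sort geq [seq #|C|./2 | C : {set 'I_n.*2} <-
    enum (equivalence_partition (connect (coset_graph w)) [set: 'I_n.*2])].

Definition Kset (n : nat) (l : seq nat) : {set 'S_n.*2} :=
  [set w | coset_type w == pad n l].

(* The group algebra is the library's [group_ring]: the matrices spanned by the
   regular representation, [gset_mx] being the sum of the elements of a set. *)
Definition Ksum (F : fieldType) (n : nat) (l : seq nat) :
    'M[F]_#|[set: 'S_n.*2]| :=
  gset_mx F [set: 'S_n.*2] (Kset n l).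

(* Main.v *)
(* Conjugating by x turns a permutation x of the 2n vertices into the perfect
   matching Q = x^-1 P, where P is the standard matching, and every Q arises from
   exactly 2^n n! permutations.  With W = w^-1 P, where w has coset-type rho_n,
   the coefficient of rho is therefore 2^n n! times the number of matchings Q such
   that P u Q has type lambda_n and Q u W has type delta_n.  Now P and W share
   n - |rho| pairs.  The number of admissible Q that miss exactly a given set of a
   of these shared pairs depends only on a, and vanishes for a > |lambda|, since a
   missed pair lies on a cycle of P u Q with at least four vertices.  So the count
   is a fixed linear combination of the binomials C(n - |rho|, a), a <= |lambda|. *)
Require Import Defs.
From mathcomp Require Import all_boot all_order all_fingroup all_algebra.
From mathcomp Require Import all_character.
From mathcomp Require Import reals complex.

Set Implicit Arguments.
Unset Strict Implicit.
Unset Printing Implicit Defensive.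

(** * Perfect matchings *)

(* A perfect matching is encoded as a fixed-point-free involution. *)
Definition matching (T : finType) (p : T -> T) : bool :=
  [forall x, (p (p x) == x) && (p x != x)].

Lemma matchingK (T : finType) (p : T -> T) : matching p -> involutive p.
Proof. by move=> /forallP pP x; have /andP[/eqP] := pP x. Qed.

Lemma matching_neq (T : finType) (p : T -> T) x : matching p -> p x != x.
Proof. by move=> /forallP /(_ x) /andP[]. Qed.

Lemma eq_matching (T : finType) (p q : T -> T) : p =1 q -> matching p = matching q.
Proof. by move=> eq_pq; apply: eq_forallb => x; rewrite !eq_pq. Qed.

(** [X] takes from each pair inside [A] the point of smaller [enum_rank]. Then [p] exchanges [X]
    with [A :\: X], so the two have equal size. *)
Lemma matching_transversal (T : finType) (p : T -> T) (A : {set T}) :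
    matching p -> {homo p : x / x \in A} ->
  exists X : {set T}, [/\ X \subset A, #|A| = #|X|.*2
    & {in A, forall x, (p x \in X) = (x \notin X)}].
Proof.
move=> pM pA; have pK := matchingK pM.
pose X := [set x in A | enum_rank x < enum_rank (p x)].
have XP : {in A, forall x, (p x \in X) = (x \notin X)}.
  move=> x xA; rewrite !inE xA pA //= pK -leqNgt ltn_neqAle.
  by rewrite (inj_eq val_inj) (inj_eq enum_rank_inj) matching_neq.
have sXA : X \subset A by apply/subsetP => x; rewrite inE => /andP[].
exists X; split => //.
rewrite -(cardsID X A) (setIidPr sXA) -addnn; congr (_ + _).
rewrite -(card_imset _ (inv_inj pK)); apply: eq_card => x.
apply/imsetP/idP => [[y /setDP[yA yX] ->]|xX]; first by rewrite XP.
have xA := subsetP sXA x xX.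
exists (p x); rewrite ?pK //; apply/setDP; split; first exact: pA.
by rewrite XP // negbK.
Qed.

(** Normal form of a matching: a transversal indexes the pairs, the bit tells its points ([false])
    from their partners ([true]), and [p] becomes the flip of the bit. *)
Lemma matching_enum (T : finType) (p : T -> T) n :
    matching p -> #|T| = n.*2 ->
  exists f : 'I_n * bool -> T, bijective f /\
    forall k b, f (k, ~~ b) = p (f (k, b)).
Proof.
move=> pM cT; have pK := matchingK pM.
have [|X [_ cX XP]] := @matching_transversal _ _ [set: T] pM.
  by move=> x; rewrite !inE.
have eqn : n = #|X|.
  by apply: double_inj; rewrite -cX cardsT.
pose t k := enum_val (cast_ord eqn k).
have tX k : t k \in X by apply: enum_valP.
pose f (kb : 'I_n * bool) := if kb.2 then p (t kb.1) else t kb.1.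
have fX k b : (f (k, b) \in X) = ~~ b.
  by case: b; rewrite /f /= ?XP ?inE ?tX.
exists f; split; last by move=> k [] /=; rewrite /f /= ?pK.
apply: inj_card_bij; last by rewrite cT card_prod card_ord card_bool muln2.
move=> [k b] [l d] eq_f.
have eq_bd : b = d by apply: negb_inj; rewrite -(fX k) -(fX l) eq_f.
congr pair => //; subst d; apply: (@cast_ord_inj _ _ eqn).
apply: enum_val_inj; rewrite -/(t k) -/(t l).
by move: eq_f; rewrite /f /=; case: b {fX} => // /(inv_inj pK).
Qed.

Lemma matching_iso (T T' : finType) (p : T -> T) (p' : T' -> T') n :
    matching p -> matching p' -> #|T| = n.*2 -> #|T'| = n.*2 ->
  exists f : T -> T', bijective f /\ forall x, f (p x) = p' (f x).
Proof.
move=> pM pM' cT cT'.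
have [f [[g fK gK] fP]] := matching_enum pM cT.
have [f' [bijf' fP']] := matching_enum pM' cT'.
exists (f' \o g); split; first by apply: bij_comp => //; exists f.
move=> x /=; rewrite -{1}(gK x); case: (g x) => k b.
by rewrite -fP fK fP'.
Qed.

(** In the coordinates of [matching_enum], carrying [q] to [p] amounts to permuting the [n] pairs
    and choosing independently for each whether to flip it. These maps form a coset of a
    hyperoctahedral group. *)
Lemma card_matching_iso (T : finType) (p q : T -> T) n :
    matching p -> matching q -> #|T| = n.*2 ->
  #|[set x : {perm T} | [forall i, x (q i) == p (x i)]]| = 2 ^ n * n`!.
Proof.
move=> pM qM cT.
have [f [[g fK gK] fP]] := matching_enum qM cT.
have [f' [[g' fK' gK'] fP']] := matching_enum pM cT.
pose h (se : 'S_n * {ffun 'I_n -> bool}) t :=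
  f' (se.1 (g t).1, (g t).2 (+) se.2 (g t).1).
have h_inj se : injective (h se).
  move=> t u /(can_inj fK') [/perm_inj eq1].
  rewrite eq1 => /addIb eq2; apply: (can_inj gK).
  by move: (g t) (g u) eq1 eq2 => [? ?] [? ?] /= -> ->.
pose H se := perm (@h_inj se).
have H_inj : injective H.
  move=> [s e] [s' e'] /permP eqH.
  have eqk k : s k = s' k /\ e k = e' k.
    have := eqH (f (k, false)); rewrite !permE /h /= fK /=.
    by move=> /(can_inj fK') [].
  by congr pair; [apply/permP => k | apply/ffunP => k]; case: (eqk k).
transitivity #|H @: [set: _]|; last first.
  rewrite card_imset // cardsT card_prod card_Sn card_ffun.
  by rewrite card_bool card_ord mulnC.
apply: eq_card => x; rewrite inE; apply/forallP/imsetP => [xP|[[s e] _ ->] i].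
  (* [y k] is the pair and the bit to which [x] sends the [false] end of pair [k]; the permutation
     of pairs and the flips are read off from it. *)
  pose y k := g' (x (f (k, false))).
  have y_inj : injective (fun k => (y k).1).
    move=> k l eq_y; have xf b m : x (f (m, b)) = f' ((y m).1, b (+) (y m).2).
      case: b; rewrite /= -?[true]/(~~ false).
        rewrite fP (eqP (xP _)) fP' -surjective_pairing.
        by rewrite /y gK'.
      by rewrite -surjective_pairing /y gK'.
    (* The bit at [l] is chosen so that [x] takes the same value there as at [(k, false)];
       injectivity then forces [k = l]. *)
    have := xf ((y k).2 (+) (y l).2) l; rewrite -eq_y -addbA addbb addbF.
    by rewrite -surjective_pairing {2}/y gK' => /perm_inj /(can_inj fK) [].
  exists (perm y_inj, [ffun k => (y k).2]) => //.
  apply/permP => t; rewrite permE /h /= permE ffunE.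
  rewrite -{1}(gK t); case: (g t) => k [] /=; last first.
    by rewrite -surjective_pairing /y gK'.
  rewrite -[true]/(~~ false) fP (eqP (xP _)) fP' -surjective_pairing.
  by rewrite /y gK'.
have [[k b] ->] : exists kb, i = f kb by exists (g i).
by rewrite !permE /h -fP !fK /= -fP' addNb.
Qed.

(** * Components of the union of two matchings *)

Definition union_graph (T : finType) (p q : T -> T) : rel T :=
  fun x y => (y == p x) || (y == q x).

Definition component (T : finType) (p q : T -> T) (x : T) : {set T} :=
  [set y | connect (union_graph p q) x y].

Definition components (T : finType) (p q : T -> T) : {set {set T}} :=
  [set component p q x | x : T].

(* The type of the union of two matchings, without its parts equal to 1: this is
   unchanged when common pairs are added. *)
Definition proper_type (T : finType) (p q : T -> T) : seq nat :=
  [seq #|C|./2 | C : {set T} <- enum (components p q) & 1 < #|C|./2].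

Lemma eq_union_graph (T : finType) (p p' q q' : T -> T) :
  p =1 p' -> q =1 q' -> union_graph p q =2 union_graph p' q'.
Proof. by move=> eq_p eq_q x y; rewrite /union_graph eq_p eq_q. Qed.

Lemma eq_proper_type (T : finType) (p p' q q' : T -> T) :
  p =1 p' -> q =1 q' -> proper_type p q = proper_type p' q'.
Proof.
move=> eq_p eq_q; rewrite /proper_type.
suff -> : components p q = components p' q' by [].
apply: eq_imset => x; apply/setP => y; rewrite !inE.
exact/eq_connect/eq_union_graph.
Qed.

Lemma union_graph_sym (T : finType) (p q : T -> T) :
  involutive p -> involutive q -> symmetric (union_graph p q).
Proof.
move=> pK qK x y; rewrite /union_graph.
by rewrite -(inv_eq pK) -(inv_eq qK) eq_sym [_ == q y]eq_sym.
Qed.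

Lemma components_partition (T : finType) (p q : T -> T) :
    involutive p -> involutive q ->
  components p q = equivalence_partition (connect (union_graph p q)) setT
  /\ partition (components p q) setT.
Proof.
move=> pK qK.
have -> : components p q = equivalence_partition (connect (union_graph p q)) setT.
  apply/setP => C; apply/imsetP/imsetP => -[x _ ->]; exists x => //.
    by apply/setP => y; rewrite !inE.
  by apply/setP => y; rewrite !inE.
split=> //; apply: equivalence_partitionP => x y z _ _ _; split=> // xy.
exact: (same_connect (sym_connect_sym (union_graph_sym pK qK)) xy).
Qed.

Lemma component_closed (T : finType) (p q : T -> T) x :
    involutive p -> involutive q ->
  {homo p : y / y \in component p q x} /\ {homo q : y / y \in component p q x}.
Proof.
by move=> pK qK; split=> y; rewrite !inE => xy; apply: connect_trans xy _;
  apply: connect1; rewrite /union_graph eqxx ?orbT.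
Qed.

(** A component is stable under [p], hence a union of pairs of [p]. *)
Lemma even_component (T : finType) (p q : T -> T) x :
  matching p -> matching q -> ~~ odd #|component p q x|.
Proof.
move=> pM qM; have [pC _] := component_closed x (matchingK pM) (matchingK qM).
have [X [_ -> _]] := matching_transversal pM pC.
by rewrite odd_double.
Qed.

(** * Components and types under an equivariant injection *)

Section Embedding.

Variables (T T' : finType) (p q : T -> T) (p' q' : T' -> T') (f : T' -> T).
Hypothesis pK : involutive p.
Hypothesis f_inj : injective f.
Hypothesis (fp : forall x, f (p' x) = p (f x)) (fq : forall x, f (q' x) = q (f x)).

Lemma component_image x : component p q (f x) = f @: component p' q' x.
Proof.
apply/setP => y; rewrite inE; apply/idP/imsetP => [/connectP[s]|[z]].
  elim: s x => [|z s IHs] x /=; first by move=> _ ->; exists x; rewrite ?inE.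
  move=> /andP[xz path_s] eq_y.
  have [t t_z xt] : exists2 t, z = f t & union_graph p' q' x t.
    case/orP: xz => /eqP->; [exists (p' x)|exists (q' x)];
      by rewrite ?fp ?fq // /union_graph eqxx ?orbT.
  subst z; have [u] := IHs t path_s eq_y.
  rewrite inE => tu ->; exists u => //; rewrite inE.
  exact: connect_trans (connect1 xt) tu.
rewrite inE => /connectP[s path_s ->] ->; apply/connectP.
exists (map f s); rewrite ?last_map //.
rewrite path_map; apply: sub_path path_s => u v.
by rewrite /union_graph /= -fp -fq !(inj_eq f_inj).
Qed.

Hypothesis off_f : forall y, y \notin codom f -> q y = p y.

(** The complement of the image is stable under [p], and [q] agrees with [p] there, so no path from
    [y] leaves [[set y; p y]]. *)
Lemma component_off y : y \notin codom f -> #|component p q y|./2 <= 1.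
Proof.
move=> y_f; have py_f : p y \notin codom f.
  apply: contra y_f => /codomP[x eq_py]; apply/codomP; exists (p' x).
  by rewrite fp -eq_py pK.
suff sC : component p q y \subset [set y; p y].
  have := half_leq (subset_leq_card sC); rewrite cards2.
  by case: eqP => _ le; rewrite (leq_trans le).
apply/subsetP => z; rewrite inE => /connectP[s path_s ->].
suff last_C t : t \in [set y; p y] -> path (union_graph p q) t s ->
    last t s \in [set y; p y].
  by apply: last_C; rewrite ?inE ?eqxx.
elim: s {path_s} t => //= u s IHs t t_y /andP[tu]; apply: IHs.
by move: tu t_y; rewrite !inE => /orP[]/eqP-> /orP[]/eqP->;
   rewrite ?(off_f y_f) ?(off_f py_f) ?pK ?eqxx ?orbT.
Qed.

(** Components meeting the image are copies of components upstairs, of the same size; all others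
    have half-size at most 1, which [proper_type] discards. This serves both for relabelling
    vertices and for deleting common pairs. *)
Lemma proper_type_image : perm_eq (proper_type p q) (proper_type p' q').
Proof.
have h_f (C : {set T'}) : #|f @: C| = #|C| by rewrite card_imset.
pose s := [seq C : {set T'} <- enum (components p' q') | 1 < #|C|./2].
have -> : proper_type p' q' =
    [seq #|C|./2 | C : {set T} <- [seq f @: (C : {set T'}) | C <- s]].
  by rewrite -map_comp; apply: eq_map => C /=; rewrite h_f.
apply: perm_map; apply: uniq_perm; first by rewrite filter_uniq ?enum_uniq.
  rewrite map_inj_uniq; first by rewrite filter_uniq ?enum_uniq.
  exact: imset_inj.
move=> C; rewrite mem_filter mem_enum; apply/andP/mapP => [[gt1 /imsetP[y _ eqC]]|].
  case: (boolP (y \in codom f)) => [/codomP[x eq_y]|/component_off].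
    exists (component p' q' x); last by rewrite eqC eq_y component_image.
    rewrite mem_filter mem_enum imset_f // andbT.
    by rewrite -h_f -component_image -eq_y -eqC.
  by rewrite -eqC leqNgt gt1.
move=> [D]; rewrite mem_filter mem_enum => /andP[gt1 /imsetP[x _ eqD]] ->.
rewrite /= h_f gt1; split=> //; rewrite eqD -component_image.
exact: imset_f.
Qed.

End Embedding.

Lemma sum_components (T : finType) (p q : T -> T) n :
    matching p -> matching q -> #|T| = n.*2 ->
  \sum_(C in components p q) #|C|./2 = n.
Proof.
move=> pM qM cT; apply: double_inj; rewrite -cT -cardsT.
have [_ /card_partition ->] := components_partition (matchingK pM) (matchingK qM).
rewrite -muln2 big_distrl /=; apply: eq_bigr => C /imsetP[x _ ->].
by rewrite muln2 even_halfK // even_component.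
Qed.

(** * Padded partitions *)

Lemma pad_sorted n l : proper_partition l -> sorted geq (pad n l).
Proof.
move=> /andP[l_sorted l_gt1]; rewrite /pad.
have geq_trans : transitive geq by move=> x y z /= xy yz; apply: leq_trans yz xy.
rewrite (sorted_pairwise geq_trans) pairwise_cat -!(sorted_pairwise geq_trans).
rewrite l_sorted /=; apply/andP; split.
  apply/allrelP => x y /(allP l_gt1) x_gt1 /nseqP[-> _]; exact: ltnW.
by case: (n - _) => //= m; elim: m.
Qed.

Lemma filter_pad n l : proper_partition l -> [seq k <- pad n l | 1 < k] = l.
Proof.
move=> /andP[_ /all_filterP l_gt1]; rewrite filter_cat l_gt1.
by rewrite (eq_in_filter (a2 := pred0)) ?filter_pred0 ?cats0 // => k /nseqP[->].
Qed.

(** Once the total [n] is fixed, the number of parts equal to 1 is determined by the parts greater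
    than 1. Coset-types can thus be compared through [proper_type], without sorting. *)
Lemma sort_eq_pad (M l : seq nat) n :
    proper_partition l -> sumn l <= n -> all (leq 1) M -> sumn M = n ->
  (sort geq M == pad n l) = perm_eq [seq k <- M | 1 < k] l.
Proof.
move=> l_proper le_l_n M_gt0 sumM.
have geq_trans : transitive geq by move=> x y z /= xy yz; apply: leq_trans yz xy.
have geq_anti : antisymmetric geq by move=> x y; rewrite andbC -eqn_leq => /eqP.
have geq_total : total geq by move=> x y; apply: leq_total.
rewrite -{2}(filter_pad n l_proper).
transitivity (perm_eq M (pad n l)).
  apply/eqP/idP => [<-|eq_M]; first by rewrite perm_sym perm_sort.
  apply: (sorted_eq geq_trans) => //; [exact: sort_sorted|exact: pad_sorted|].
  by rewrite perm_sort.
apply/idP/idP => [|eq_M]; first exact: perm_filter.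
have M_split : perm_eq M ([seq k <- M | 1 < k] ++ nseq (count (pred1 1) M) 1).
  rewrite -(perm_filterC (fun k => 1 < k)) perm_cat2l.
  have /all_pred1P : all (pred1 1) [seq k <- M | ~~ (1 < k)].
    apply/allP => k; rewrite mem_filter -leqNgt => /andP[k_le1 kM].
    by rewrite /= eqn_leq k_le1 (allP M_gt0).
  rewrite size_filter => ->.
  suff -> : count (predC (fun k => 1 < k)) M = count (pred1 1) M by [].
  apply: eq_in_count => k kM; rewrite /= -leqNgt eqn_leq.
  by rewrite (allP M_gt0 k kM : 0 < k) andbT.
rewrite (filter_pad n l_proper) in eq_M.
rewrite (permPl M_split) /pad perm_cat //.
suff -> : count (pred1 1) M = n - sumn l by [].
have := perm_sumn M_split; rewrite sumn_cat (perm_sumn eq_M) sumM => ->.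
by rewrite sumn_nseq mul1n addKn.
Qed.

(** * Counting matchings of given types *)

Definition typed_matchings (T : finType) (p w : T -> T) (l d : seq nat) :
    {set {ffun T -> T}} :=
  [set q : {ffun T -> T} | [&& matching q, perm_eq (proper_type p q) l
     & perm_eq (proper_type q w) d]].

(** * Matchings that agree with [p] outside an embedded vertex set *)

Section Restriction.

Variables (T T' : finType) (p w : T -> T) (p' w' : T' -> T') (f : T' -> T).
Hypotheses (pM : matching p) (f_inj : injective f).
Hypotheses (fp : forall x, f (p' x) = p (f x)) (fw : forall x, f (w' x) = w (f x)).
Hypothesis off_f : forall y, y \notin codom f -> w y = p y.
Variables (l d : seq nat) (P : pred {ffun T -> T}) (P' : pred {ffun T' -> T'}).

Let extends (q : {ffun T -> T}) (q' : {ffun T' -> T'}) :=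
  (forall x, f (q' x) = q (f x)) /\ (forall y, y \notin codom f -> q y = p y).

Hypothesis extP : forall q q', extends q q' -> P q = P' q'.

Lemma matching_extends q q' : extends q q' -> matching q = matching q'.
Proof.
move=> [fq q_off]; apply/forallP/forallP => qM x.
  by rewrite -!(inj_eq f_inj) !fq.
have [/codomP[z ->]|x_f] := boolP (x \in codom f).
  by rewrite -!fq !(inj_eq f_inj).
have px_f : p x \notin codom f.
  apply: contra x_f => /codomP[z eq_px]; apply/codomP; exists (p' z).
  by rewrite fp -eq_px (matchingK pM).
by rewrite !q_off // (matchingK pM) eqxx matching_neq.
Qed.

(** Off the image [q], [w] and [p] all agree, so [proper_type_image] applies to both unions, that of
    [p] and [q] and that of [q] and [w]. *)
Lemma typed_matchings_extends q q' : extends q q' ->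
  (q \in typed_matchings p w l d) = (q' \in typed_matchings p' w' l d).
Proof.
move=> ext_q; rewrite !inE -(matching_extends ext_q).
have [fq q_off] := ext_q; case qM : (matching q) => //=.
have pt := proper_type_image (matchingK pM) f_inj fp fq q_off.
have qt : perm_eq (proper_type q w) (proper_type q' w').
  apply: (proper_type_image (matchingK qM) f_inj fq fw) => y y_f.
  by rewrite q_off ?off_f.
by rewrite (permPl pt) (permPl qt).
Qed.

(** Extension by [p] is a bijection between the two sets. [P] and [P'] carry a further condition
    along, later one on the moved pairs or a trivial one. *)
Lemma card_typed_matchings_extends :
  #|[set q in typed_matchings p w l d |
      [forall y, (y \notin codom f) ==> (q y == p y)] && P q]|
  = #|[set q in typed_matchings p' w' l d | P' q]|.
Proof.
pose ext (q' : {ffun T' -> T'}) : {ffun T -> T} :=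
  [ffun y => if [pick x | f x == y] is Some x then f (q' x) else p y].
have extE q' : extends (ext q') q'.
  split=> [x|y y_f]; rewrite ffunE; case: pickP => [z|].
  - by move=> /eqP/f_inj->.
  - by move/(_ x); rewrite eqxx.
  - by move=> /eqP eq_y; rewrite -eq_y codom_f in y_f.
  by [].
have ext_inj : injective ext.
  move=> q1 q2 eq_ext; apply/ffunP => x; apply: f_inj.
  by rewrite (proj1 (extE q1)) (proj1 (extE q2)) eq_ext.
rewrite -(card_imset _ ext_inj); apply: eq_card => q.
rewrite inE; apply/andP/imsetP => [[q_t /andP[/forallP q_off Pq]]|[q' q'_t ->]].
  have qM : matching q by move: q_t; rewrite inE => /andP[].
  have {}q_off y : y \notin codom f -> q y = p y.
    by move=> y_f; apply/eqP; apply: implyP (q_off y) y_f.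
  (* The default [x] is never taken: if [q (f x)] were off the image, [q] would act on it as [p], so
     that [q (f x) = p (f x) = f (p' x)], which is in the image. *)
  pose q' := [ffun x => odflt x [pick z | f z == q (f x)]].
  have ext_q : extends q q'.
    split=> // x; rewrite ffunE; case: pickP => [z /eqP-> //|no_z].
    have qfx : q (f x) \notin codom f.
      by apply/codomP => -[z eq_z]; have := no_z z; rewrite eq_z eqxx.
    have := q_off _ qfx; rewrite (matchingK qM) => eq_x.
    by move: qfx; rewrite -(matchingK pM (q _)) -eq_x -fp codom_f.
  exists q'.
    by rewrite inE -(extP ext_q) Pq -(typed_matchings_extends ext_q) q_t.
  apply/ffunP => y; have [extf ext_off] := extE q'; have [fq _] := ext_q.
  have [/codomP[x ->]|y_f] := boolP (y \in codom f); first by rewrite -extf -fq.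
  by rewrite ext_off ?q_off.
move: q'_t; rewrite inE => /andP[q'_t P'q'].
rewrite (typed_matchings_extends (extE q')) (extP (extE q')); split=> //.
rewrite P'q' andbT; apply/forallP => y; apply/implyP => /(proj2 (extE q'))->.
exact: eqxx.
Qed.

End Restriction.

(** * Counting by the set of common pairs that are missed *)

Section CommonPairs.

Variables (U : finType) (pU wU : U -> U).
Hypothesis pUM : matching pU.

(* For a matching g of U, the matching of U + K * bool that has in addition one
   pair for each k : K; these pairs are common to all matchings so obtained. *)
Definition add_pairs (K : finType) (g : U -> U) (z : U + K * bool) : U + K * bool :=
  match z with
  | inl u => inl (g u)
  | inr (k, b) => inr (k, ~~ b)
  end.

Lemma matching_add_pairs (K : finType) (g : U -> U) :
  matching g -> matching (@add_pairs K g).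
Proof.
move=> gM; apply/forallP => -[u|[k b]] /=; last first.
  by rewrite negbK eqxx /= (inj_eq (@inr_inj _ _)) xpair_eqE eqxx; case: b.
by rewrite (matchingK gM) eqxx (inj_eq (@inl_inj _ _)) matching_neq.
Qed.

(* The added pairs that q does not contain. *)
Definition moved_pairs (K : finType) (q : {ffun U + K * bool -> U + K * bool}) :
    {set K} :=
  [set k | q (inr (k, false)) != inr (k, true)].

Variables l d : seq nat.

Definition typed_add_pairs (K : finType) :=
  typed_matchings (@add_pairs K pU) (@add_pairs K wU) l d.

(** These numbers are the coefficients of the binomials in the final count; they do not involve the
    total number of added pairs. *)
Definition all_moved_count (a : nat) : nat :=
  #|[set q in typed_add_pairs 'I_a | moved_pairs q == setT]|.

(** The added pairs outside [A] belong to [q] as well, so they can be deleted without changing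
    either type; enumerating [A] identifies what is left with the case of ['I_#|A|]. *)
Lemma card_moved_pairs (K : finType) (A : {set K}) :
  #|[set q in typed_add_pairs K | moved_pairs q == A]| = all_moved_count #|A|.
Proof.
pose f (z : U + 'I_#|A| * bool) : U + K * bool :=
  match z with inl u => inl u | inr (i, b) => inr (enum_val i, b) end.
have f_inj : injective f.
  by move=> [u|[i b]] [v|[j c]] //= [] // => [->|/enum_val_inj-> ->].
have fg g z : f (add_pairs g z) = add_pairs g (f z) by case: z => [|[]].
have f_off y : y \notin codom f -> exists k b, y = inr (k, b) /\ k \notin A.
  case: y => [u /negP[]|[k b] y_f]; first by apply/codomP; exists (inl u).
  exists k, b; split=> //; apply: contra y_f => kA; apply/codomP.
  by exists (inr (enum_rank_in kA k, b)); rewrite /= enum_rankK_in.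
have pM := matching_add_pairs K pUM.
rewrite /all_moved_count.
rewrite -(@card_typed_matchings_extends _ _ _ _ _ _ f pM f_inj (fg pU) (fg wU) _ _ _
  (fun q => moved_pairs q == A)) /=.
- apply: eq_card => q; rewrite !inE; apply: andb_id2l => /and3P[qM _ _].
  apply: esym; apply: andb_idl => /eqP moved_q; apply/forallP => y; apply/implyP.
  move=> /f_off[k [b [-> kA]]]; move: kA; rewrite -moved_q inE negbK => /eqP q_k.
  by case: b => //=; rewrite ?q_k // -q_k (matchingK qM).
- by move=> y /f_off[k [b [-> _]]].
move=> q q' [fq q_off].
have moved_q i : (i \in moved_pairs q') = (enum_val i \in moved_pairs q).
  by rewrite !inE -(inj_eq f_inj) fq.
apply/eqP/eqP => [mA|mT]; first by apply/setP => i; rewrite moved_q mA enum_valP inE.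
apply/setP => k; have [kA|kA] := boolP (k \in A).
  by rewrite -(enum_rankK_in kA kA) -moved_q mT inE.
apply/negbTE; rewrite inE negbK q_off //; apply/codomP => -[[//|[i b]] [eq_k _]].
by rewrite eq_k enum_valP in kA.
Qed.

(** The matchings are sorted by their set of moved pairs and these sets by cardinality, the count
    depending on the cardinality alone. *)
Lemma card_typed_add_pairs (K : finType) :
  #|typed_add_pairs K| = \sum_(a < #|K|.+1) 'C(#|K|, a) * all_moved_count a.
Proof.
rewrite -sum1_card (partition_big (@moved_pairs K) xpredT) //=.
rewrite (partition_big (fun A : {set K} => inord #|A| : 'I_#|K|.+1) xpredT) //=.
apply: eq_bigr => a _; transitivity (\sum_(A : {set K} | #|A| == a) all_moved_count a).
  apply: eq_big => [A|A /eqP <-].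
    by rewrite -(inj_eq val_inj) /= inordK // ltnS max_card.
  rewrite inordK ?ltnS ?max_card // -card_moved_pairs -sum1_card.
  by apply: eq_bigl => q; rewrite inE.
by rewrite sum_nat_cond_const -card_draws cardsE.
Qed.

(** If every added pair is moved, the 2a added vertices all lie on components of half-size greater
    than 1 of the union with [p]. These components have 2|l| vertices in total, whence a <= |l|. *)
Lemma all_moved_count_eq0 a : sumn l < a -> all_moved_count a = 0.
Proof.
apply: contraTeq; rewrite -leqNgt cards_eq0 => /set0Pn[q]; rewrite !inE.
move=> /andP[/and3P[qM type_q _] /eqP moved_q].
pose p := @add_pairs 'I_a pU; have pM : matching p := matching_add_pairs _ pUM.
pose S := [set C in components p q | 1 < #|C|./2].
have sumS : \sum_(C in S) #|C| = (sumn l).*2.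
  rewrite -(perm_sumn type_q) sumnE big_map big_filter big_enum_cond /=.
  rewrite -muln2 big_distrl /=; apply: eq_big => [C|C]; first by rewrite inE.
  move=> /setIdP[/imsetP[x _ ->] _].
  by rewrite muln2 even_halfK // even_component.
rewrite -leq_double -sumS; apply: leq_trans (leq_card_cover S).
have inr_inj : injective (fun kb : 'I_a * bool => inr kb : U + 'I_a * bool) by move=> ? ? [].
rewrite -{1}(card_ord a) -muln2 -card_bool -card_prod -cardsT -(card_imset _ inr_inj).
apply: subset_leq_card; apply/subsetP => _ /imsetP[[k b] _ ->].
pose x : U + 'I_a * bool := inr (k, false).
have [pC qC] := component_closed x (matchingK pM) (matchingK qM).
have xC : x \in component p q x by rewrite inE connect0.
apply/bigcupP; exists (component p q x); last first.
  by case: b => //; apply: (pC x).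
rewrite inE imset_f //=.
have : k \in moved_pairs q by rewrite moved_q inE.
rewrite inE => q_k.
(* The points [x], [p x] and [q x] are distinct because the pair is moved; by parity the component
   then has at least four vertices. *)
have gt2 : 2 < #|component p q x|.
  have s3 : [set x; p x; q x] \subset component p q x.
    by apply/subsetP => z; rewrite !inE -orbA => /or3P[]/eqP->; rewrite -?[connect _ _ _]inE;
      [move: xC|move: (pC _ xC)|move: (qC _ xC)]; rewrite inE.
  apply: leq_trans (subset_leq_card s3).
  rewrite setUC cardsU1 cards2 !inE negb_or [x == _]eq_sym.
  by rewrite (matching_neq x pM) (matching_neq x qM) q_k.
have := even_component x pM qM.
by move: gt2; case: #|component p q x| => [|[|[|[|m]]]].
Qed.

End CommonPairs.

(** * Coset-types and structure coefficients *)

(** The value [~~ odd i + i./2.*2] is [i] with its last binary digit flipped, which exchanges 2r and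
    2r+1. *)
Lemma mate_subproof n (i : 'I_n.*2) : ~~ odd i + i./2.*2 < n.*2.
Proof. by rewrite -ltn_half_double half_bit_double ltn_half_double. Qed.

Definition mate n (i : 'I_n.*2) : 'I_n.*2 := Ordinal (mate_subproof i).

Lemma pairedE n (i j : 'I_n.*2) : paired i j = (j == mate i).
Proof.
rewrite /paired -!(inj_eq val_inj) /=.
apply/andP/eqP => [[neq_ij /eqP eq_half]|->]; last first.
  rewrite half_bit_double eqxx; split=> //; apply: contraFneq (addbb (odd i)) => {1}->.
  by rewrite oddD odd_double addbF oddb addNb addbb.
rewrite -(odd_double_half j) eq_half; congr (nat_of_bool _ + _).
move: neq_ij; rewrite -{1}(odd_double_half i) -{1}(odd_double_half j) eq_half.
by rewrite eqn_add2r; case: odd; case: odd.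
Qed.

Lemma matching_mate n : matching (@mate n).
Proof.
apply/forallP => i; apply/andP; split.
  rewrite -(inj_eq val_inj) /= oddD odd_double addbF oddb negbK half_bit_double.
  by rewrite odd_double_half.
by have := pairedE i (mate i); rewrite eqxx eq_sym => /andP[].
Qed.

(* The matching x^-1 P, P being the standard one. *)
Definition twist n (x : 'S_n.*2) : {ffun 'I_n.*2 -> 'I_n.*2} :=
  [ffun i => (x^-1)%g (mate (x i))].

(** This puts the fibres of [twist] into the form counted by [card_matching_iso]. *)
Lemma twistP n (x : 'S_n.*2) (q : {ffun 'I_n.*2 -> 'I_n.*2}) :
  (twist x == q) = [forall i, x (q i) == mate (x i)].
Proof.
apply/eqP/forallP => [<- i|xq]; first by rewrite ffunE permKV.
by apply/ffunP => i; rewrite ffunE -(eqP (xq i)) permK.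
Qed.

Lemma matching_twist n (x : 'S_n.*2) : matching (twist x).
Proof.
have mM := matching_mate n.
apply/forallP => i; rewrite !ffunE permKV (matchingK mM) permK eqxx /=.
by rewrite -(inj_eq (@perm_inj _ x)) permKV matching_neq.
Qed.

(** The two kinds of edges of the coset graph are the pairs of [mate] and those of [twist x], so its
    components are those of the union of these two matchings. *)
Lemma mem_Kset n (x : 'S_n.*2) l : proper_partition l -> sumn l <= n ->
  (x \in Kset n l) = perm_eq (proper_type (@mate n) (twist x)) l.
Proof.
move=> l_proper le_l_n; rewrite inE /coset_type.
have mM := matching_mate n; have tM := matching_twist x.
have [eqP_comp _] := components_partition (matchingK mM) (matchingK tM).
have -> : equivalence_partition (connect (coset_graph x)) setT =
    components (@mate n) (twist x).
  rewrite eqP_comp; apply: eq_imset => i; apply/setP => j; rewrite !inE /=.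
  apply: eq_connect => {}i {}j; rewrite /coset_graph !pairedE /union_graph.
  by rewrite ffunE -[j == (_ : perm_type _) _](inj_eq (@perm_inj _ x)) permKV.
have cT : #|'I_n.*2| = n.*2 by rewrite card_ord.
rewrite (sort_eq_pad l_proper le_l_n).
- by rewrite filter_map.
- apply/allP => _ /mapP[C + ->]; rewrite mem_enum => /imsetP[i _ ->].
  have := even_component i mM tM; have : 0 < #|component (@mate n) (twist x) i|.
    by apply/card_gt0P; exists i; rewrite inE connect0.
  by case: #|_| => [|[]].
by rewrite sumnE big_map big_enum (sum_components mM tM cT).
Qed.

(** Relabelling by [x] carries [twist x] to [mate] and [twist w] to [twist (x^-1 * w)]. Both
    conditions on [x] therefore depend only on the matching [twist x], and each matching has a fibre
    of size 2^n n!. *)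
Lemma card_Kset_factor n (w : 'S_n.*2) l d :
    proper_partition l -> proper_partition d -> sumn l <= n -> sumn d <= n ->
  #|[set x in Kset n l | (x^-1 * w)%g \in Kset n d]|
  = #|typed_matchings (@mate n) (twist w) l d| * (2 ^ n * n`!).
Proof.
move=> l_proper d_proper le_l le_d.
have mM := matching_mate n.
have XE x : (x \in Kset n l) && ((x^-1 * w)%g \in Kset n d) =
    (twist x \in typed_matchings (@mate n) (twist w) l d).
  rewrite !mem_Kset // inE matching_twist /=; congr andb; apply: (permPl _ d).
  (* [x] is onto, so there is no such [y]. *)
  have xV y : y \notin codom x -> twist (x^-1 * w)%g y = mate y.
    by rewrite -[y](permKV x) codom_f.
  apply: proper_type_image xV => //; first exact: matchingK mM.
  - exact: perm_inj.
  - by move=> i; rewrite ffunE permKV.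
  by move=> i; rewrite !ffunE invMg invgK !permM permK.
have -> : [set x in Kset n l | (x^-1 * w)%g \in Kset n d] =
    [set x | twist x \in typed_matchings (@mate n) (twist w) l d].
  by apply/setP => x; rewrite in_set [RHS]in_set; apply: XE.
pose M := typed_matchings (@mate n) (twist w) l d.
rewrite -sum1_card (partition_big (@twist n) (mem M)) /=; last by move=> x; rewrite in_set.
rewrite -sum_nat_const; apply: eq_bigr => q q_t.
have qM : matching q by move: q_t; rewrite inE => /and3P[].
rewrite -(card_matching_iso mM qM) ?card_ord // -sum1_card.
apply: eq_bigl => x; rewrite !in_set -twistP andb_idl //.
by move=> /eqP->; move: q_t; rewrite in_set.
Qed.

(** * Coefficients in the group algebra and polynomiality of binomial sums *)

Section Coefficients.

Import GRing.Theory Num.Theory.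
Local Open Scope ring_scope.

Lemma coef_gset_mx (F : fieldType) (gT : finGroupType) (A : {set gT}) (w : gT) :
  gring_proj (G := [set: gT]) w (gset_mx F [set: gT] A) = (w \in A)%:R.
Proof.
rewrite /gset_mx raddf_sum /= (eq_bigr (fun x => (w == x)%:R)); last first.
  by move=> x _; rewrite gring_projE ?inE.
have [wA|wA] := boolP (w \in A).
  rewrite (bigD1 w) //= eqxx big1 ?addr0 // => x /andP[_].
  by rewrite eq_sym => /negbTE->.
by rewrite big1 // => x xA; case: eqP => // eq_wx; rewrite eq_wx xA in wA.
Qed.

(** The coefficient counts the factorisations w = xy with x in [A] and y in [B], and y is determined
    by x. *)
Lemma coef_mul_gset_mx (F : fieldType) (gT : finGroupType) (A B : {set gT}) (w : gT) :
  gring_proj (G := [set: gT]) w (gset_mx F [set: gT] A *m gset_mx F [set: gT] B)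
  = #|[set x in A | (x^-1 * w)%g \in B]|%:R.
Proof.
rewrite {1}/gset_mx mulmx_suml raddf_sum /= -sum1_card natr_sum.
rewrite big_mkcond [RHS]big_mkcond; apply: eq_bigr => x _ /=.
rewrite inE; case: (x \in A) => //=.
have -> : regular_repr F [set: gT] x *m gset_mx F [set: gT] B =
    gset_mx F [set: gT] [set (x * y)%g | y in B].
  rewrite /gset_mx mulmx_sumr big_imset; last by move=> y z _ _ /mulgI.
  by apply: eq_bigr => y _; rewrite repr_mxM ?inE.
rewrite coef_gset_mx; have -> : (w \in [set (x * y)%g | y in B]) = ((x^-1 * w)%g \in B).
  apply/imsetP/idP => [[y yB ->]|xwB]; first by rewrite mulKg.
  by exists (x^-1 * w)%g; rewrite // mulKVg.
by case: (_ \in B).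
Qed.

(** The coefficient of the single permutation [w] is compared on both sides. Only the term of [rho]
    contributes on the right, since a proper partition is recovered from its padding by dropping the
    1s. *)
Lemma structure_coef (F : fieldType) n (c : seq nat -> F) l d rho (w : 'S_n.*2) :
    proper_partition rho -> (sumn rho <= n)%N -> w \in Kset n rho ->
    Ksum F n l *m Ksum F n d =
      \sum_(r <- proper_partitions_upto n) c r *: Ksum F n r ->
  c rho = #|[set x in Kset n l | (x^-1 * w)%g \in Kset n d]|%:R.
Proof.
move=> rho_proper le_rho w_rho /(congr1 (gring_proj (G := [set: 'S_n.*2]) w)).
rewrite coef_mul_gset_mx raddf_sum /=.
rewrite (bigD1_seq rho) ?uniq_proper_partitions_upto //=; last first.
  by rewrite mem_proper_partitions_upto rho_proper.
rewrite big_seq_cond big1 => [|r]; last first.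
  rewrite mem_proper_partitions_upto => /andP[/andP[r_proper le_r] neq_r].
  rewrite linearZ /= coef_gset_mx; suff -> : w \in Kset n r = false by rewrite scaler0.
  apply: contraNF neq_r; move: w_rho; rewrite !inE => /eqP-> /eqP/(congr1 (filter (leq 2))).
  by rewrite !filter_pad // => ->.
(* [gring_proj] takes values in 1 x 1 matrices, hence the passage to the entry at [0 0]. *)
rewrite addr0 linearZ /= coef_gset_mx w_rho => /matrixP/(_ 0 0).
by rewrite mulmxnE !mxE eqxx mulr1 => <-.
Qed.

(** C(n - r, a) is the falling factorial of n - r divided by a!, and [b a] is that falling factorial
    as a polynomial in n. *)
Lemma binomial_sum_poly (F : numFieldType) (f : nat -> nat) m r :
  exists p : {poly rat}, forall n : nat, (r <= n)%N ->
    (\sum_(a < m) 'C(n - r, a) * f a)%:R = (map_poly ratr p).[n%:R] :> F.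
Proof.
pose b a : {poly rat} := \prod_(i < a) ('X - (r + i)%:R%:P).
exists (\sum_(a < m) ((f a)%:R / a`!%:R) *: b a) => n le_rn.
rewrite -(ratr_nat F n) horner_map -[LHS]ratr_nat; congr ratr.
rewrite natr_sum horner_sum; apply: eq_bigr => a _; rewrite hornerZ.
have -> : (b a).[n%:R] = ((n - r) ^_ a)%:R.
  rewrite horner_prod ffact_prod.
  (* For n - r < a the truncated and the true product both contain the factor of index n - r, which
     is 0; otherwise no subtraction is truncated. *)
  have [lt_a|le_a] := ltnP (n - r) a.
    rewrite (bigD1 (Ordinal lt_a)) //= hornerXsubC subnKC // subrr mul0r.
    by rewrite [X in X%:R](bigD1 (Ordinal lt_a)) //= subnn mul0n.
  rewrite natr_prod; apply: eq_bigr => i _; rewrite hornerXsubC -natrB ?subnDA //.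
  by rewrite -leq_subRL // (leq_trans _ le_a) // ltnW.
rewrite -bin_ffact !natrM -mulrA [_^-1 * _]mulrC mulfK; first by rewrite mulrC.
by rewrite pnatr_eq0 -lt0n fact_gt0.
Qed.

End Coefficients.

(* A part k is realised by the cycle (j, false), (j, true), (j - 1, false),
   (j - 1, true), ... on 'I_k * bool. *)
Lemma exists_type rho : proper_partition rho ->
  exists (U : finType) (p w : U -> U), [/\ matching p, matching w,
    #|U| = (sumn rho).*2 & perm_eq (proper_type p w) rho].
Proof.
move=> /andP[_ rho_gt1].
pose k (i : 'I_(size rho)) := nth 0 rho i.
have k_gt1 i : 1 < k i by apply: (allP rho_gt1); apply: mem_nth.
pose U : finType := ({i : 'I_(size rho) & 'I_(k i)} * bool)%type.
pose p (u : U) : U := (u.1, ~~ u.2).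
pose w (u : U) : U :=
  (Tagged (fun i => 'I_(k i)) (if u.2 then ord_pred (tagged u.1) else ordS (tagged u.1)), ~~ u.2).
have rhoE : rho = [seq k i | i <- enum 'I_(size rho)].
  rewrite -[LHS](mkseq_nth 0) /mkseq -val_enum_ord -map_comp.
  by apply: eq_map.
have pM : matching p.
  by apply/forallP => -[x []]; rewrite /p /= eqxx xpair_eqE eqxx.
have wM : matching w.
  apply/forallP => -[[i j] b]; rewrite /w /= negbK !xpair_eqE eqxx andbT.
  have -> : ~~ b == b = false by case: b.
  by rewrite andbF andbT; case: b; rewrite /= ?ord_predK ?ordSK.
have cU : #|U| = (sumn rho).*2.
  rewrite card_prod card_bool muln2 card_tagged; congr (_.*2).
  by rewrite (congr1 sumn rhoE); congr sumn; apply: eq_map => i; apply: card_ord.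
exists U, p, w; split => //.
(* The blocks [S i] are the components: both matchings preserve the tag, and each block is connected
   through its base vertex [z]. *)
pose S i : {set U} := [set u | tag u.1 == i].
have SE u : component p w u = S (tag u.1).
  apply/setP => v; rewrite !inE; apply/idP/eqP => [uv|].
    pose a := [pred v : U | tag v.1 == tag u.1].
    have a_closed : closed (union_graph p w) a.
      by move=> x y /orP[]/eqP->.
    by have := closed_connect a_closed uv; rewrite !inE eqxx => /esym/eqP.
  case: u => [[i j] b]; case: v => [[i' j'] b'] /= eq_i; subst i'.
  have c_sym := sym_connect_sym (union_graph_sym (matchingK pM) (matchingK wM)).
  pose z : 'I_(k i) := Ordinal (ltnW (k_gt1 i)).
  pose el (j : 'I_(k i)) (b : bool) : U := (Tagged (fun i => 'I_(k i)) j, b).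
  suff from_z t c : connect (union_graph p w) (el z false) (el t c).
    by apply: connect_trans (from_z j' b'); rewrite c_sym; apply: from_z.
  have p_step s e : connect (union_graph p w) (el s e) (el s (~~ e)).
    by apply: connect1; rewrite /union_graph eqxx.
  suff from_z_false : connect (union_graph p w) (el z false) (el t false).
    by case: c => //; apply: connect_trans from_z_false (p_step _ _).
  case: t => m; elim: m => [|m IHm] lt_m.
    have -> : Ordinal lt_m = z by apply: val_inj.
    exact: connect0.
  apply: connect_trans (IHm (ltnW lt_m)) _.
  (* [w] leads from (m, false) to (m+1, true) and [p] resets the bit; [ordS] does not wrap around
     since m+1 is below [k i]. *)
  apply: connect_trans (p_step _ true); apply: connect1.
  apply/orP; right; rewrite /w /=; apply/eqP; congr (Tagged _ _, _).
  by apply: val_inj; rewrite /= modn_small.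
have cS i : #|S i| = (k i).*2.
  pose h (x : 'I_(k i) * bool) : U := (Tagged (fun i => 'I_(k i)) x.1, x.2).
  have h_inj : injective h.
    by move=> [x b] [y e] /eqP; rewrite xpair_eqE eq_Tagged => /andP[/eqP/= -> /eqP/= ->].
  transitivity #|h @: setT|; last first.
    by rewrite card_imset // cardsT card_prod card_ord card_bool muln2.
  apply: eq_card => -[[i' j] b]; rewrite inE /=; apply/eqP/imsetP => [eq_i|[[x e] _ []] //].
  by subst i'; exists (j, b).
suff : perm_eq (proper_type p w) [seq k i | i <- enum 'I_(size rho)] by rewrite -rhoE.
rewrite /proper_type.
have -> : [seq k i | i <- enum 'I_(size rho)] =
    [seq #|C|./2 | C : {set U} <- [seq S i | i <- enum 'I_(size rho)]].
  by rewrite -map_comp; apply: eq_map => i /=; rewrite cS doubleK.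
have S_inj : injective S.
  move=> i i' eqS; have : (Tagged (fun i => 'I_(k i)) (Ordinal (ltnW (k_gt1 i))), true) \in S i.
    by rewrite inE.
  by rewrite eqS inE => /eqP.
apply/perm_map/uniq_perm; first by rewrite filter_uniq ?enum_uniq.
  by rewrite map_inj_uniq ?enum_uniq.
move=> C; rewrite mem_filter mem_enum; apply/andP/mapP => [[_ /imsetP[u _ ->]]|[i _ ->]].
  by exists (tag u.1); rewrite ?mem_enum.
rewrite cS doubleK k_gt1; split=> //; apply/imsetP.
by exists (Tagged (fun i => 'I_(k i)) (Ordinal (ltnW (k_gt1 i))), true); rewrite ?SE.
Qed.

(** The model on [U] is enlarged by n - |rho| common pairs and transported to the 2n vertices so
    that the enlarged [pU] becomes [mate]. The range of summation is cut at |l| in order not to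
    depend on n. *)
Lemma card_typed_matchings (U : finType) (pU wU : U -> U) l d rho n :
    matching pU -> matching wU -> #|U| = (sumn rho).*2 -> sumn rho <= n ->
    perm_eq (proper_type pU wU) rho ->
  exists w : 'S_n.*2, perm_eq (proper_type (@mate n) (twist w)) rho /\
    #|typed_matchings (@mate n) (twist w) l d| =
    \sum_(a < (sumn l).+1) 'C(n - sumn rho, a) * all_moved_count pU wU l d a.
Proof.
move=> pUM wUM cU le_rho type_U.
pose K := 'I_(n - sumn rho); pose p := @add_pairs U K pU; pose w := @add_pairs U K wU.
have pM : matching p by apply: matching_add_pairs.
have wM : matching w by apply: matching_add_pairs.
have mM := matching_mate n.
have cZ : #|{: U + K * bool}| = n.*2.
  rewrite card_sum card_prod card_bool cU card_ord muln2 -doubleD.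
  by rewrite subnKC.
have cI : #|'I_n.*2| = n.*2 by rewrite card_ord.
have [f [[g fK gK] fp]] := matching_iso pM mM cZ cI.
pose W i := f (w (g i)).
have fw z : f (w z) = W (f z) by rewrite /W fK.
have WM : matching W.
  apply/forallP => i; rewrite /W fK (matchingK wM) gK eqxx /=.
  by rewrite -(inj_eq (can_inj gK)) fK matching_neq.
have f_off i : i \notin codom f -> W i = mate i by rewrite -(gK i) codom_f.
(* All matchings of the vertices are isomorphic, so [W] is of the form [twist y]. *)
have [x [x_bij xW]] := matching_iso WM mM cI cI.
pose y : 'S_n.*2 := perm (bij_inj x_bij).
have twist_y : twist y =1 W.
  by move=> i; apply: (@perm_inj _ y); rewrite ffunE permKV !permE xW.
exists y; split.
  rewrite (eq_proper_type (frefl _) twist_y) -(permPr type_U).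
  apply: (@proper_type_image _ _ _ _ _ _ (fun u => f (inl u))).
  - exact: matchingK.
  - by move=> u v /(can_inj fK) [].
  - by move=> u; rewrite -fp.
  - by move=> u; rewrite -fw.
  move=> i; rewrite -(gK i); case: (g i) => [u|[k b]] i_f.
    by case/negP: i_f; apply: (codom_f (fun u => f (inl u))).
  by rewrite -fw -fp.
transitivity #|typed_add_pairs pU wU l d K|.
  transitivity #|[set q in typed_matchings (@mate n) (twist y) l d |
      [forall i, (i \notin codom f) ==> (q i == mate i)] && xpredT q]|.
    apply: eq_card => q; rewrite [RHS]in_set andbT andb_idr // => _.
    by apply/forallP => i; rewrite -(gK i) codom_f.
  rewrite (@card_typed_matchings_extends _ _ _ _ p w _ mM (can_inj fK) fp _ _ _ _ _ xpredT) //.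
  - by apply: eq_card => q; rewrite in_set andbT.
  - by move=> z; rewrite twist_y fw.
  by move=> i; rewrite twist_y; apply: f_off.
rewrite card_typed_add_pairs // card_ord.
set m := n - _; pose t a := 'C(m, a) * all_moved_count pU wU l d a.
(* Both sums are brought to a common range; the excess terms vanish through the binomial when a > m
   and through [all_moved_count_eq0] when a > |l|. *)
rewrite (big_ord_widen (maxn m (sumn l)).+1 t) ?ltnS ?leq_maxl //.
rewrite [RHS](big_ord_widen (maxn m (sumn l)).+1 t) ?ltnS ?leq_maxr //.
rewrite big_mkcond [RHS]big_mkcond; apply: eq_bigr => a _; rewrite /t !ltnS.
have [le_m|lt_m] := leqP a m; have [le_l|lt_l] := leqP a (sumn l) => //.
  by rewrite all_moved_count_eq0 ?muln0.
by rewrite bin_small.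
Qed.

Local Open Scope ring_scope.

Theorem corollary5p5 (R : realType) (lambda delta : seq nat)
    (lambda_proper : proper_partition lambda)
    (delta_proper : proper_partition delta)
    (c : seq nat -> nat -> R[i]) (n0 : nat)
    (c_def : forall n : nat, (n0 <= n)%N ->
      Ksum R[i] n lambda *m Ksum R[i] n delta =
      \sum_(rho <- proper_partitions_upto n) c rho n *: Ksum R[i] n rho)
    (rho : seq nat) (rho_proper : proper_partition rho) :
  exists (p : {poly rat}) (N : nat), forall n : nat, (N <= n)%N ->
    c rho n / (2 ^ n * n`!)%:R = (map_poly ratr p).[n%:R].
Proof.
(* The model of type [rho] is fixed before n is introduced, so the numbers [all_moved_count], and
   with them the polynomial, are the same for all n. *)
have [U [pU [wU [pUM wUM cU type_U]]]] := exists_type rho_proper.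
have [p pE] := binomial_sum_poly R[i]
  (all_moved_count pU wU lambda delta) (sumn lambda).+1 (sumn rho).
exists p, (maxn n0 (maxn (sumn lambda) (maxn (sumn delta) (sumn rho)))) => n.
rewrite !geq_max => /and4P[le_n0 le_lambda le_delta le_rho].
have [w [type_w card_w]] := card_typed_matchings lambda delta pUM wUM cU le_rho type_U.
have w_rho : w \in Kset n rho by rewrite mem_Kset.
rewrite -pE // -card_w (structure_coef (c := c ^~ n) rho_proper le_rho w_rho (c_def n le_n0)).
rewrite card_Kset_factor // GRing.natrM GRing.mulfK //.
by rewrite Num.Theory.pnatr_eq0 -lt0n muln_gt0 expn_gt0 fact_gt0.
Qed.
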